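(* Let $a=\frac{1}{50}$, $b=\frac{1}{80}$, $c=\frac{1}{20}$. Let $N\ge 1$, $m>0$, $\kappa>0$, and let $\{\theta_i^0\}_{i=1}^N,\{\omega_i^0\}_{i=1}^N,\{\nu_i\}_{i=1}^N$ be real numbers. Let $\{\theta_i(t)\}_{i=1}^N$, $t\ge 0$, be the solution of the inertial Winfree system with these parameters and initial data, let $R(t)$ be its order parameter, and put $R_0:=R(0)$. Assume $R_0>0$ and $$\frac{\max_i |\nu_i|}{\kappa}<a\,R_0^{3/2},\qquad m\kappa<b\,R_0^{3/2},\qquad \frac{\max_i |\omega_i^0|}{\kappa}<c\,R_0^{3/2}.$$ Then: (1) (Oscillator death) for every $i\in\{1,\dots,N\}$ the limits $\theta_i^\infty:=\lim_{t\to\infty}\theta_i(t)$ (in $\mathbb{R}$) and $\lim_{t\to\infty}\dot\theta_i(t)=0$ exist; (2) (Lower bound on the order parameter) $\inf_{t\ge 0}R(t)\ge \frac{R_0}{4}$.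
   Context: The inertial (second-order) Winfree system with $N$ oscillators, inertia $m>0$, coupling strength $\kappa$, and natural frequencies $\nu_i\in\mathbb{R}$ is the Cauchy problem for real-valued functions $\theta_i(t)$, $i=1,\dots,N$: $$m\ddot\theta_i+\dot\theta_i=\nu_i-\frac{\kappa}{N}\sum_{j=1}^N(1+\cos\theta_j(t))\sin\theta_i(t)\quad(t>0),\qquad (\theta_i,\dot\theta_i)(0)=(\theta_i^0,\omega_i^0).$$ It has a unique global solution on $[0,\infty)$. The order parameter is $R(t)=\frac1N\sum_{j=1}^N(1+\cos\theta_j(t))\in[0,2]$. *)

(* Defs.v *)
From HB Require Import structures.
From mathcomp Require Import all_boot all_order all_algebra.
From mathcomp Require Import all_classical all_reals all_analysis.

Set Implicit Arguments.
Unset Strict Implicit.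
Unset Printing Implicit Defensive.

Import Order.TTheory GRing.Theory Num.Theory.
Import numFieldNormedType.Exports.

Local Open Scope classical_set_scope.
Local Open Scope ring_scope.

Definition order_parameter (R : realType) (N : nat) (theta : 'I_N -> R -> R)
    (t : R) : R :=
  N%:R^-1 * \sum_(j < N) (1 + cos (theta j t)).

(* The default value 0 is harmless: the family consists of absolute values, so
   this is the usual maximum as soon as [0 < N]. *)
Definition max_abs (R : realType) (N : nat) (x : 'I_N -> R) : R :=
  \big[Num.max/0]_(i < N) `|x i|.

(* Classical solutions on [0, +oo[, twice differentiable on ]0, +oo[ and C^1 up
   to t = 0.  The values of [theta i] at negative times are irrelevant, so the
   velocity at t = 0 is the right derivative, and C^1 regularity at 0 is the
   convergence of [derive1 (theta i)] to it. *)
Definition winfree_solution (R : realType) (N : nat) (m kappa : R)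
    (nu theta0 omega0 : 'I_N -> R) (theta : 'I_N -> R -> R) : Prop :=
  forall i : 'I_N,
    [/\ theta i 0 = theta0 i,
        h^-1 * (theta i h - theta i 0) @[h --> 0^'+] --> omega0 i,
        derive1 (theta i) t @[t --> 0^'+] --> omega0 i &
        forall t : R, 0 < t ->
          [/\ derivable (theta i) t 1,
              derivable (derive1 (theta i)) t 1 &
              m * derive1 (derive1 (theta i)) t + derive1 (theta i) t =
              nu i - kappa / N%:R *
                \sum_(j < N) (1 + cos (theta j t)) * sin (theta i t)]].

(* Main.v *)
(* For a lower bound on the order parameter R, consider z_i = theta_i + m theta_i':
   it solves z_i' = nu_i - kappa R sin theta_i, a small perturbation of the
   first-order system since m |theta_i'| = O(m kappa), and this holds without
   any initial layer.  Let Q = avg (1 + cos z).  At a time when Q' <= 0,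
   avg sin^2 z must be small, so about Q / 2 of the phases lie in the half circle
   cos z >= 0, which they cannot leave.

   Once R is bounded below the phases are trapped, so the energy, whose
   derivative is - sum theta_i'^2, is bounded, and Barbalat's lemma applied
   twice gives theta_i' -> 0 and theta_i'' -> 0.  Hence R sin theta_i - nu_i / kappa -> 0
   and the signs of cos theta_i are eventually constant: R asymptotically solves
   R = 1 + avg (+- sqrt (1 - (nu_i / (kappa R))^2)), whose right-hand side is a
   contraction in R, so R is Cauchy at infinity and so are the phases. *)
Require Import Defs.
From HB Require Import structures.
From mathcomp Require Import all_boot all_order all_algebra.
From mathcomp Require Import all_classical all_reals all_analysis.
From mathcomp Require Import ring lra.

Set Implicit Arguments.
Unset Strict Implicit.
Unset Printing Implicit Defensive.

Import Order.TTheory GRing.Theory Num.Theory.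
Import numFieldNormedType.Exports.

Local Open Scope classical_set_scope.
Local Open Scope ring_scope.

(** * Derivatives, the mean value theorem and invariance of an orthant *)

Lemma is_derive_continuous (R : realType) (f : R -> R) (x df : R) :
  is_derive x 1 f df -> {for x, continuous f}.
Proof. by case=> /derivable1_diffP/differentiable_continuous. Qed.

Lemma is_derive_gt0_right (R : realType) (f : R -> R) (x df : R) :
  is_derive x 1 f df -> 0 < df ->
  exists2 e, 0 < e & forall y, x < y < x + e -> f x < f y.
Proof.
move=> fx df0; have [/cvg_ex[/= l fl] fE] := fx.
have ldf : l = df by rewrite -fE; apply/esym/cvg_lim.
have : \forall h \near 0^', 0 < h^-1 *: ((f \o shift x) (h *: 1) - f x).
  by apply: (fl [set y | 0 < y]); apply: lt_nbhsr; rewrite ldf.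
rewrite near_withinE => /nbhs_ballP[e/= e0 he].
exists e => // y /andP[xy ye].
have h0 : 0 < y - x by rewrite subr_gt0.
have /he/= : ball 0 e (y - x).
  by rewrite /ball/= sub0r normrN gtr0_norm// ltrBlDl.
rewrite gt_eqF// => /(_ isT).
by rewrite scaler1 subrK pmulr_rgt0 ?invr_gt0// subr_gt0.
Qed.

Lemma mean_value (R : realType) (f df : R -> R) (a b : R) : a <= b ->
  (forall x, a <= x <= b -> is_derive x 1 f (df x)) ->
  exists2 c, a <= c <= b & f b - f a = df c * (b - a).
Proof.
move=> ab fdf.
have [||c cab E] := @MVT_segment R f df a b ab.
- by move=> x; rewrite in_itv/= => /andP[ax xb]; apply: fdf; rewrite !ltW.
- apply: derivable_within_continuous => x; rewrite in_itv/= => /fdf.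
  by case.
- by exists c.
Qed.

(* First-exit-time argument: the closed orthant can only be left at a point
   where some component vanishes, and there that component increases. *)
Lemma barrier (R : realType) (I : finType) (f df : I -> R -> R) (a b : R) :
  a <= b ->
  (forall i t, a <= t <= b -> is_derive t 1 (f i) (df i t)) ->
  (forall i, 0 <= f i a) ->
  (forall t, a <= t <= b -> (forall i, 0 <= f i t) ->
    forall i, f i t = 0 -> 0 < df i t) ->
  forall i, 0 <= f i b.
Proof.
move=> ab fdf fa fup.
pose A := [set t | a <= t <= b /\ forall s, a <= s <= t -> forall i, 0 <= f i s].
have Aa : A a.
  split; first by rewrite lexx.
  by move=> s /le_anti <-.
have Ab : ubound A b by move=> t [/andP[]].
have supA : has_sup A by split; [exists a | exists b].
set u := sup A.
have au : a <= u by apply: ub_le_sup => //; exists b.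
have ub : u <= b by apply: ge_sup => //; exists a.
have flt s : a <= s < u -> forall i, 0 <= f i s.
  move=> /andP[sa su].
  have [t [_ At] st] := sup_adherent (eps := u - s) ltac:(by rewrite subr_gt0) supA.
  by apply: At; rewrite sa/= ltW//; move: st; rewrite subKr.
have fu i : 0 <= f i u.
  rewrite leNgt; apply/negP => fu0.
  have : a < u.
    by rewrite lt_neqAle au andbT; apply: contraTneq fu0 => <-; rewrite -leNgt.
  move=> {}au.
  have cf : {for u, continuous (f i)}.
    by apply: (@is_derive_continuous _ _ _ (df i u)); apply: fdf; rewrite ltW.
  have /nbhs_ballP[e/= e0 he] : \forall t \near u, f i t < 0.
    exact: (cf _ (lt_nbhsl fu0)).
  (* [s] lies in [[a, u[] and in the ball where component [i] is negative, against [flt]. *)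
  pose s := Num.max a (u - e / 2).
  have su : s < u by rewrite /s gt_max au/= ltrBlDr ltrDl divr_gt0.
  have := he s; rewrite /ball/= => /(_ _)/wrap[].
    rewrite ger0_norm ?subr_ge0 ?ltW//.
    have : u - e / 2 <= s by rewrite /s le_max lexx orbT.
    lra.
  by apply/negP; rewrite -leNgt flt// su andbT /s le_max lexx.
have [ubE|] := eqVneq u b; first by rewrite -ubE.
move=> unb; have {unb ub} ub : u < b by rewrite lt_neqAle unb ub.
(* Just after [u], a component vanishing at [u] has increased and a positive one is still positive;
   finiteness of [I] gives a common [e]. *)
have : exists2 e, 0 < e & forall y, u < y < u + e -> forall i, 0 <= f i y.
  suff /(_ (enum I)) [e e0 he] : forall s : seq I,
      exists2 e, 0 < e & forall y, u < y < u + e -> forall i, i \in s -> 0 <= f i y.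
    by exists e => // y uy i; apply: he => //; rewrite mem_enum.
  elim=> [|i s [e e0 he]]; first by exists 1.
  have uab : a <= u <= b by rewrite au ltW.
  have [e' e'0 he'] : exists2 e, 0 < e & forall y, u < y < u + e -> 0 <= f i y.
    have [fiu|fiu] := eqVneq (f i u) 0.
      have [e' e'0 he'] := is_derive_gt0_right (fdf i u uab) (fup u uab fu i fiu).
      by exists e' => // y /he'; rewrite fiu => /ltW.
    have {}fiu : 0 < f i u by rewrite lt_neqAle eq_sym fiu fu.
    have cf := is_derive_continuous (fdf i u uab).
    have /nbhs_ballP[e'/= e'0 he'] : \forall t \near u, 0 < f i t.
      exact: (cf _ (lt_nbhsr fiu)).
    exists e' => // y /andP[uy ye]; apply/ltW/he'.
    by rewrite /ball/= ltr0_norm ?subr_lt0// opprB ltrBlDl.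
  exists (Num.min e e') => [|y /andP[uy]]; first by rewrite lt_min e0.
  rewrite addr_minr lt_min => /andP[ye ye'] j; rewrite inE => /orP[/eqP ->|js].
    by apply: he'; rewrite uy.
  by apply: he => //; rewrite uy.
move=> [e e0 he].
pose v := Num.min b (u + e / 2).
have uv : u < v by rewrite /v lt_min ub ltrDl divr_gt0.
have : A v.
  split; first by rewrite (le_trans au (ltW uv))/= /v ge_min lexx.
  move=> s /andP[sa sv] i.
  have [su|us|->] := ltgtP s u; last exact: fu.
    by apply: flt; rewrite sa.
  apply: he; rewrite us/=.
  have : v <= u + e / 2 by rewrite /v ge_min lexx orbT.
  lra.
move=> /(ub_le_sup supA.2).
by rewrite leNgt uv.
Qed.

Lemma lipschitz_of_derive (R : realType) (f df : R -> R) (K a b : R) :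
  (forall t, a <= t -> is_derive t 1 f (df t)) ->
  (forall t, a <= t -> `|df t| <= K) ->
  a <= b -> forall c, b <= c -> `|f c - f b| <= K * (c - b).
Proof.
move=> fdf dfK ab c bc.
have [|d /andP[bd dc] ->] := @mean_value _ f df b c bc.
  by move=> x /andP[bx xc]; apply: fdf; apply: le_trans bx.
by rewrite normrM (ger0_norm (x := c - b)) ?subr_ge0// ler_wpM2r ?subr_ge0 ?dfK//
  (le_trans ab).
Qed.

(** * Asymptotics at infinity and Barbalat's lemma *)

Definition cauchy_pinfty (R : realType) (f : R -> R) :=
  forall e, 0 < e -> exists T, forall s t, T <= s -> T <= t -> `|f s - f t| <= e.

Definition vanishes_pinfty (R : realType) (f : R -> R) :=
  forall e, 0 < e -> exists T, forall t, T <= t -> `|f t| <= e.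

Lemma vanishes_cauchy (R : realType) (f : R -> R) :
  vanishes_pinfty f -> cauchy_pinfty f.
Proof.
move=> f0 e e0; have [|T hT] := f0 (e / 2); first by rewrite divr_gt0.
exists T => s t /hT fs /hT ft; rewrite (le_trans (ler_normB _ _))//.
by rewrite (splitr e) lerD.
Qed.

Lemma vanishes_cvg (R : realType) (f : R -> R) :
  vanishes_pinfty f -> f t @[t --> +oo] --> 0.
Proof.
move=> f0; apply/cvgrPdist_le => e /f0[T hT].
by near=> t; rewrite sub0r normrN; apply: hT; near: t; apply: nbhs_pinfty_ge; rewrite num_real.
Unshelve. all: by end_near. Qed.

Lemma cauchy_pinfty_cvg (R : realType) (f : R -> R) :
  cauchy_pinfty f -> exists l : R, f t @[t --> +oo] --> l.
Proof.
move=> fC; apply/cvg_ex; apply/cauchy_cvgP; apply/cauchy_exP => e e0.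
have [|T hT] := fC (e / 2); first by rewrite divr_gt0.
exists (f T); change (\forall t \near +oo, ball (f T) e (f t)); near=> t.
have Tt : T <= t by near: t; apply: nbhs_pinfty_ge; rewrite num_real.
by rewrite /ball/= (le_lt_trans (hT T t _ _))// ltr_pdivrMr// ltr_pMr// ltr1n.
Unshelve. all: by end_near. Qed.

Lemma nonincreasing_lb_cauchy (R : realType) (f : R -> R) (a m : R) :
  (forall s t, a <= s -> s <= t -> f t <= f s) -> (forall t, a <= t -> m <= f t) ->
  cauchy_pinfty f.
Proof.
move=> fdec fm e e0; pose A := [set f t | t in [set t | a <= t]].
have infA : has_inf A.
  by split; [exists (f a), a => /=|exists m => _ [t + <-]; exact: fm].
have [_ [T/= aT <-] hT] := inf_adherent e0 infA.
have lb t : T <= t -> inf A <= f t.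
  move=> Tt; apply: ge_inf; first by case: infA.
  by exists t => //=; apply: le_trans Tt.
exists T => s t Ts Tt.
have := lb s Ts; have := lb t Tt; have := fdec _ _ aT Ts; have := fdec _ _ aT Tt.
by rewrite ler_norml; lra.
Qed.

(** Over a window of length [h] the mean slope of [f] is small because [f] is Cauchy, and [df],
    being [K]-Lipschitz, differs from that slope by at most [K * h]. *)
Lemma barbalat (R : realType) (f df ddf : R -> R) (a K : R) :
  (forall t, a <= t -> is_derive t 1 f (df t)) ->
  (forall t, a <= t -> is_derive t 1 df (ddf t)) ->
  (forall t, a <= t -> `|ddf t| <= K) ->
  cauchy_pinfty f -> vanishes_pinfty df.
Proof.
move=> f' f'' ddfK fC e e0.
have K0 : 0 <= K by apply: le_trans (ddfK a _).
(* Using [K + 1] instead of [K] keeps the denominator positive when [K = 0]. *)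
pose h := e / (2 * (K + 1)).
have h0 : 0 < h by rewrite divr_gt0// mulr_gt0// ltr_wpDl.
have Kh : (K + 1) * h = e / 2.
  by rewrite /h; field; rewrite gt_eqF// ltr_wpDl.
have [|T hT] := fC (h * (e / 2)); first by rewrite mulr_gt0// divr_gt0.
exists (Num.max a T) => t; rewrite ge_max => /andP[at_ Tt].
have th : t <= t + h by rewrite lerDl ltW.
have [|c /andP[tc ch] E] := @mean_value _ f df t (t + h) th.
  by move=> x /andP[tx _]; apply: f'; apply: le_trans tx.
have := lipschitz_of_derive f'' ddfK at_ tc.
have := hT (t + h) t (le_trans Tt th) Tt.
rewrite E addrAC subrr add0r normrM (gtr0_norm h0) mulrC ler_pM2l// => dc ddc.
have : K * (c - t) <= e / 2.
  rewrite -Kh (le_trans (y := K * h))//; first by rewrite ler_wpM2l// lerBlDl.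
  by rewrite ler_wpM2r ?ltW// ltrDl.
move=> Kc; rewrite -[df t](subKr (df c)).
by rewrite (le_trans (ler_normB _ _))// (splitr e) lerD// (le_trans ddc).
Qed.

(** * The order parameter and its persistence under perturbed first-order dynamics *)

Lemma is_derive_fsum (R : realType) (N : nat) (f : 'I_N -> R -> R)
    (df : 'I_N -> R) (t : R) :
  (forall i, is_derive t 1 (f i) (df i)) ->
  is_derive t 1 (fun x => \sum_(i < N) f i x) (\sum_(i < N) df i).
Proof.
move=> fdf; have -> : (fun x => \sum_(i < N) f i x) = \sum_(i < N) f i.
  by apply/funext => x; rewrite fct_sumE.
exact: is_derive_sum.
Qed.

Lemma is_derive_cos_comp (R : realType) (f : R -> R) (t df : R) :
  is_derive t 1 f df -> is_derive t 1 (fun x => cos (f x)) (- sin (f t) * df).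
Proof. exact: (is_derive1_comp (f := cos)). Qed.

Lemma is_derive_sin_comp (R : realType) (f : R -> R) (t df : R) :
  is_derive t 1 f df -> is_derive t 1 (fun x => sin (f x)) (cos (f t) * df).
Proof. exact: (is_derive1_comp (f := sin)). Qed.

Lemma is_derive_order_parameter (R : realType) (N : nat) (z : 'I_N -> R -> R)
    (dz : 'I_N -> R) (t : R) :
  (forall i, is_derive t 1 (z i) (dz i)) ->
  is_derive t 1 (order_parameter z) (N%:R^-1 * \sum_(i < N) (- sin (z i t) * dz i)).
Proof.
move=> zdz; apply: is_deriveZ; apply: is_derive_fsum => i.
rewrite -[X in is_derive _ _ _ X]add0r.
by apply: is_deriveD; apply: is_derive_cos_comp.
Qed.

Lemma order_parameter_ge0 (R : realType) (N : nat) (z : 'I_N -> R -> R) (t : R) :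
  0 <= order_parameter z t.
Proof.
rewrite mulr_ge0 ?invr_ge0//; apply: sumr_ge0 => j _.
by rewrite -lerBlDl sub0r cos_geN1.
Qed.

Lemma mean_le (R : realType) (N : nat) (F : 'I_N -> R) (c : R) : (0 < N)%N ->
  (forall i, F i <= c) -> N%:R^-1 * \sum_(i < N) F i <= c.
Proof.
move=> N0 Fc; rewrite mulrC ler_pdivrMr ?ltr0n// (le_trans (ler_sum _ (fun i _ => Fc i)))//.
by rewrite sumr_const card_ord mulr_natr.
Qed.

Lemma order_parameter_le2 (R : realType) (N : nat) (z : 'I_N -> R -> R) (t : R) :
  (0 < N)%N -> order_parameter z t <= 2.
Proof.
by move=> N0; apply: mean_le => // i; rewrite -[leRHS]/(1 + 1) lerD2l cos_le1.
Qed.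

Lemma cos_lipschitz (R : realType) (x y : R) : `|cos x - cos y| <= `|x - y|.
Proof.
wlog yx : x y / y <= x.
  by move=> h; have [/h//|/ltW/h] := leP y x; rewrite distrC (distrC y).
have [c _ ->] := mean_value yx (fun t _ => is_derive_cos t).
by rewrite normrM normrN ler_piMl// sin_max.
Qed.

Lemma sin_lipschitz (R : realType) (x y : R) : `|sin x - sin y| <= `|x - y|.
Proof.
by rewrite -!cosBpihalf (le_trans (cos_lipschitz _ _))// opprB addrA subrK.
Qed.

Lemma dist_order_parameter (R : realType) (N : nat) (y z : 'I_N -> R -> R)
    (s t c : R) : (0 < N)%N ->
  (forall i, `|cos (y i s) - cos (z i t)| <= c) ->
  `|order_parameter y s - order_parameter z t| <= c.
Proof.
move=> N0 yz; rewrite -mulrBr -sumrB normrM ger0_norm ?invr_ge0//.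
apply: le_trans (mean_le N0 yz); rewrite ler_wpM2l ?invr_ge0//.
rewrite (le_trans (ler_norm_sum _ _ _))// ler_sum// => i _.
by rewrite opprD addrACA subrr add0r.
Qed.

(* If Q falls below q, it does so through a time at which Q = q and Q' <= 0;
   there most of Q is carried by the phases in the half circle cos >= 0, and
   that half circle cannot be left while Q >= p. *)
Lemma order_parameter_persists (R : realType) (N : nat) (z dz : 'I_N -> R -> R)
    (rho : R -> R) (kappa d e q p t0 : R) : (0 < N)%N -> 0 < kappa ->
  (forall i t, t0 <= t -> is_derive t 1 (z i) (dz i t)) ->
  (forall i t, t0 <= t -> `|dz i t + kappa * rho t * sin (z i t)| <= kappa * d) ->
  (forall t, t0 <= t -> `|order_parameter z t - rho t| <= e) ->
  q <= order_parameter z t0 -> e < q -> d + e < p ->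
  d ^+ 2 <= (q - 2 * p) * (q - e) ^+ 2 -> 0 <= p ->
  forall t, t0 <= t -> p <= order_parameter z t.
Proof.
move=> N0 k0 z' zerr Qrho Qt0 eq dep dqp p0 t1 t01.
set Q := order_parameter z in Qt0 Qrho *.
have Npos : 0 < N%:R :> R by rewrite ltr0n.
have qp : p <= q.
  suff : 0 <= q - 2 * p by lra.
  have : 0 < (q - e) ^+ 2 by rewrite exprn_gt0 ?subr_gt0.
  by move/pmulr_lge0 <-; rewrite (le_trans _ dqp)// sqr_ge0.
pose dQ t := N%:R^-1 * \sum_(i < N) (- sin (z i t) * dz i t).
have Q' t : t0 <= t -> is_derive t 1 Q (dQ t).
  by move=> t0t; apply: is_derive_order_parameter => i; apply: z'.
(* Without such a time, the barrier argument for [Q - q] alone already gives [p <= q <= Q t1]. *)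
have [[ts [/andP[t0s st1] Qs dQs]]|noex] := pselect (exists ts,
    [/\ t0 <= ts <= t1, Q ts = q & dQ ts <= 0]); last first.
  apply: (le_trans qp); rewrite -subr_ge0.
  apply: (@barrier R unit (fun _ t => Q t - q) (fun _ => dQ) t0 t1) => //.
  - move=> _ t /andP[tt0 _]; rewrite -[dQ t]subr0; apply: is_deriveB => //.
    exact: Q'.
  - by move=> _; rewrite subr_ge0.
  - move=> t tt _ _ /subr0_eq Qt; rewrite ltNge; apply/negP => dQt.
    by apply: noex; exists t.
have sdz i t : t0 <= t ->
    kappa * (rho t * sin (z i t) ^+ 2 - `|sin (z i t)| * d) <= - sin (z i t) * dz i t.
  move=> /(zerr i); set s := sin _; set x := dz i t => xs.
  have -> : - s * x = kappa * rho t * s ^+ 2 - s * (x + kappa * rho t * s) by ring.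
  rewrite mulrBr mulrA lerD2l lerN2 (le_trans (ler_norm _))// normrM mulrCA.
  by rewrite ler_wpM2l.
have rhos : q - e <= rho ts.
  by have := Qrho _ t0s; rewrite Qs ler_norml => /andP[]; lra.
have rhos0 : 0 < rho ts by apply: lt_le_trans rhos; rewrite subr_gt0.
(* Since [(rho |s| - d)^2 >= 0], one has [2 rho (rho s^2 - |s| d) >= rho^2 s^2 - d^2]. Averaging
   this against [dQ ts <= 0] bounds [rho^2] times the mean of [sin^2] by [d^2]. *)
have sin2 : N%:R^-1 * \sum_(i < N) sin (z i ts) ^+ 2 <= q - 2 * p.
  have h i : rho ts ^+ 2 * sin (z i ts) ^+ 2 - d ^+ 2 <=
      2 * rho ts * kappa^-1 * (- sin (z i ts) * dz i ts).
    have := sdz i _ t0s; set s := sin _; set x := - s * _.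
    rewrite -ler_pdivlMl// => sx.
    have : 2 * rho ts * (rho ts * s ^+ 2 - `|s| * d) <= 2 * rho ts * (kappa^-1 * x).
      by rewrite ler_wpM2l// mulr_ge0// ltW.
    rewrite -(mulrA (2 * rho ts)); apply: le_trans.
    have := sqr_ge0 (rho ts * `|s| - d).
    rewrite sqrrB exprMn real_normK ?num_real//.
    by lra.
  have : rho ts ^+ 2 * (N%:R^-1 * \sum_(i < N) sin (z i ts) ^+ 2) - d ^+ 2 <= 0.
    have -> : rho ts ^+ 2 * (N%:R^-1 * \sum_(i < N) sin (z i ts) ^+ 2) - d ^+ 2 =
        N%:R^-1 * \sum_(i < N) (rho ts ^+ 2 * sin (z i ts) ^+ 2 - d ^+ 2).
      rewrite sumrB -mulr_sumr sumr_const card_ord -[d ^+ 2 *+ N]mulr_natr.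
      by field; rewrite gt_eqF.
    apply: le_trans (_ : 2 * rho ts * kappa^-1 * dQ ts <= 0).
      rewrite /dQ mulrCA ler_wpM2l ?invr_ge0// mulr_sumr.
      exact: ler_sum.
    by rewrite mulr_ge0_le0// mulr_ge0 ?invr_ge0 ?mulr_ge0// ltW.
  rewrite subr_le0 => /le_trans/(_ dqp) h2.
  have qp0 : 0 <= q - 2 * p.
    have : 0 < (q - e) ^+ 2 by rewrite exprn_gt0 ?subr_gt0.
    by move/pmulr_lge0 <-; rewrite (le_trans _ dqp)// sqr_ge0.
  have r2 : 0 < rho ts ^+ 2 by rewrite exprn_gt0.
  rewrite -(ler_pM2l r2) (le_trans h2)// mulrC ler_wpM2r//.
  by rewrite lerXn2r// nnegrE ?subr_ge0 ltW.
pose S := [pred i | 0 <= cos (z i ts)].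
(* On [S], [1 + cos <= 2]; off [S] the cosine is negative and
   [1 + cos <= (1 + cos) (1 - cos) = sin^2]. *)
have cardS : N%:R * p <= #|S|%:R.
  have : N%:R * q <= 2 * #|S|%:R + N%:R * (q - 2 * p).
    rewrite ler_pdivrMl// in sin2.
    rewrite -{1}Qs /Q/order_parameter mulrA divff ?gt_eqF// mul1r.
    apply: le_trans (_ : 2 * #|S|%:R + \sum_(i < N) sin (z i ts) ^+ 2 <= _); last first.
      by rewrite lerD2l.
    rewrite -sum1_card natr_sum mulr_sumr [X in X + _]big_mkcond/=.
    rewrite -[leRHS]big_split/=.
    apply: ler_sum => i _; rewrite inE sin2cos2.
    have := cos_le1 (z i ts); have := cos_geN1 (z i ts).
    set c := cos _; case: ifPn; rewrite -?ltNge; nra.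
  lra.
have QS t : (forall i, i \in S -> 0 <= cos (z i t)) -> p <= Q t.
  move=> Sc; rewrite /Q/order_parameter ler_pdivlMl// (le_trans cardS)//.
  rewrite -sum1_card natr_sum [leLHS]big_mkcond/=; apply: ler_sum => i _.
  case: ifPn => [/Sc|_]; first by rewrite lerDl.
  by have := cos_geN1 (z i t); lra.
(* The phases of [S] are treated jointly, because [p <= Q t] is available as long as all their
   cosines are nonnegative. Where a cosine vanishes the sine has modulus 1, so the derivative of
   that cosine is at least [kappa * (rho t - d)], positive since [rho t >= p - e > d]. *)
apply: (QS) => i iS.
apply: (@barrier R {i | i \in S} (fun j t => cos (z (val j) t))
  (fun j t => - sin (z (val j) t) * dz (val j) t) ts t1 st1 _ _ _ (exist _ i iS)).
- move=> j t /andP[tst _]; apply: is_derive_cos_comp; apply: z'.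
  exact: le_trans tst.
- by move=> [j jS]; exact: jS.
move=> t /andP[tst _] Sc j cj.
have t0t := le_trans t0s tst.
have Qt : p <= Q t by apply: QS => k kS; exact: (Sc (exist _ k kS)).
apply: lt_le_trans (sdz _ _ t0t); rewrite mulr_gt0//.
have s1 : `|sin (z (val j) t)| = 1 by apply/eqP; rewrite norm_sin_eq1 cj.
rewrite -(real_normK (num_real (sin _))) s1 expr1n mulr1 mul1r.
by have := Qrho _ t0t; rewrite ler_norml => /andP[]; lra.
Qed.

(** * The second-order flow: start-up, a priori bounds, first-order reformulation *)

(** First-order form, with the velocity as a separate unknown. Only [t > 0] is covered, since
    derivatives at 0 are one-sided; the estimates below therefore start from some [t0 > 0]. *)
Definition winfree_flow (R : realType) (N : nat) (m kappa : R)
    (nu : 'I_N -> R) (theta omega : 'I_N -> R -> R) : Prop :=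
  forall (i : 'I_N) (t : R), 0 < t ->
    is_derive t 1 (theta i) (omega i t) /\
    is_derive t 1 (omega i)
      ((nu i - kappa * order_parameter theta t * sin (theta i t) - omega i t) / m).

Lemma winfree_solution_flow (R : realType) (N : nat) (m kappa : R)
    (nu theta0 omega0 : 'I_N -> R) (theta : 'I_N -> R -> R) : 0 < m ->
  winfree_solution m kappa nu theta0 omega0 theta ->
  winfree_flow m kappa nu theta (fun i => derive1 (theta i)).
Proof.
move=> m0 sol i t t0; have [_ _ _ /(_ t t0)[d1 d2 E]] := sol i.
split; first by rewrite derive1E; exact: derivableP.
apply: (is_derive_eq (derivableP d2)); rewrite -derive1E.
apply: (mulfI (lt0r_neq0 m0)); rewrite mulrCA divff ?gt_eqF// mulr1.
apply: (addIr (derive1 (theta i) t)); rewrite E subrK /order_parameter.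
by rewrite -mulr_suml !mulrA.
Qed.

(** Moves the initial data off the endpoint 0, at the price of an error [e] in the phases; the
    strict bound on the initial velocities absorbs their variation. *)
Lemma winfree_solution_start (R : realType) (N : nat) (m kappa e B : R)
    (nu theta0 omega0 : 'I_N -> R) (theta : 'I_N -> R -> R) :
  winfree_solution m kappa nu theta0 omega0 theta -> 0 < e ->
  (forall i, `|omega0 i| < B) ->
  exists2 t0, 0 < t0 & forall t, 0 < t <= t0 -> forall i,
    `|theta i t - theta i 0| <= e /\ `|derive1 (theta i) t| <= B.
Proof.
move=> sol e0 omegaB.
have : \forall t \near 0^'+, forall i,
    `|theta i t - theta i 0| <= e /\ `|derive1 (theta i) t| <= B.
  apply: filter_forall => i; have [_ dth dom _] := sol i.
  have th : theta i h - theta i 0 @[h --> 0^'+] --> 0.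
    (* Right continuity at 0 comes from the convergent difference quotient multiplied by [h]. *)
    have : h * (h^-1 * (theta i h - theta i 0)) @[h --> 0^'+] --> 0 * omega0 i.
      by apply: cvgM => //; apply/cvg_at_right_filter/cvg_id.
    rewrite mul0r; apply: cvg_trans; apply: near_eq_cvg; near=> h.
    by rewrite mulVKf// gt_eqF.
  have {}dom : \forall t \near 0^'+, `|derive1 (theta i) t| < B.
    exact: cvgr_norm_lt dom _ (omegaB i).
  near=> t; split; last by apply/ltW; near: t.
  by rewrite -normrN -sub0r; near: t; move/cvgrPdist_le : th; apply.
rewrite near_withinE => /nbhs_ballP[d/= d0 hd].
exists (d / 2) => [|t /andP[t0 td]]; first by rewrite divr_gt0.
by apply: hd => //; rewrite /ball/= sub0r normrN gtr0_norm//; lra.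
Unshelve. all: by end_near. Qed.

(** When [omega i] reaches [B] or [- B], friction beats the remaining force, which stays below [B]
    in modulus because the order parameter is at most 2. *)
Lemma winfree_flow_speed (R : realType) (N : nat) (m kappa B t0 : R)
    (nu : 'I_N -> R) (theta omega : 'I_N -> R -> R) (i : 'I_N) :
  0 < m -> 0 < kappa -> 0 < t0 -> winfree_flow m kappa nu theta omega ->
  `|nu i| + 2 * kappa < B -> `|omega i t0| <= B ->
  forall t, t0 <= t -> `|omega i t| <= B.
Proof.
move=> m0 k0 t00 flow nuB om0 t1 t01.
have N0 : (0 < N)%N by apply: leq_ltn_trans (ltn_ord i).
have force t : `|nu i - kappa * order_parameter theta t * sin (theta i t)| < B.
  apply: le_lt_trans nuB; rewrite (le_trans (ler_normB _ _))// lerD2l.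
  rewrite -mulrA normrM (gtr0_norm k0) [leRHS]mulrC ler_pM2l// normrM.
  rewrite -[leRHS]mulr1 ler_pM// ?sin_max// ger0_norm ?order_parameter_ge0//.
  exact: order_parameter_le2.
pose dom t := (nu i - kappa * order_parameter theta t * sin (theta i t) - omega i t) / m.
have om' t : t0 <= t <= t1 -> is_derive t 1 (omega i) (dom t).
  by move=> /andP[t0t _]; apply: (flow i t _).2; exact: lt_le_trans t0t.
move: om0; rewrite !ler_norml => /andP[om0 om0'].
apply/andP; split.
  rewrite -subr_ge0 opprK.
  apply: (@barrier R unit (fun _ t => omega i t + B) (fun _ t => dom t + 0) t0 t1 t01 _ _ _ tt).
  - by move=> _ t /om' ?; apply: is_deriveD.
  - by move=> _; lra.
  - move=> t _ _ _ /eqP; rewrite addr_eq0 /dom => /eqP ->.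
    rewrite addr0 divr_gt0//; have := force t; rewrite ltr_norml.
    by lra.
rewrite -subr_ge0.
apply: (@barrier R unit (fun _ t => B - omega i t) (fun _ t => 0 - dom t) t0 t1 t01 _ _ _ tt).
- by move=> _ t /om' ?; apply: is_deriveB.
- by move=> _; lra.
- move=> t _ _ _ /subr0_eq; rewrite /dom => <-.
  rewrite sub0r -mulNr divr_gt0//; have := force t; rewrite ltr_norml.
  by lra.
Qed.

(** Levels congruent to [pi / 2] modulo [2 pi] block upward motion and their opposites block
    downward motion: the sine is 1 or -1 there, and the restoring term [kappa * rho] beats the error
    [kappa * d]. *)
Lemma phase_bounded (R : realType) (z dz rho : R -> R) (kappa d t0 : R) :
  0 < kappa ->
  (forall t, t0 <= t -> is_derive t 1 z (dz t)) ->
  (forall t, t0 <= t -> `|dz t + kappa * rho t * sin (z t)| <= kappa * d) ->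
  (forall t, t0 <= t -> d < rho t) ->
  exists C, forall t, t0 <= t -> `|z t| <= C.
Proof.
move=> k0 z' zerr drho.
pose n := Num.bound `|z t0|.
(* Such a level lies above [|z t0|], because [n] does and [2 pi n >= n]. *)
pose C := pi / 2 + (pi *+ 2) *+ n : R.
have zC : `|z t0| <= C.
  rewrite (le_trans (ltW (archi_boundP (normr_ge0 _))))// -/n /C.
  have := pi_ge2 R; have : 0 <= n%:R :> R by [].
  by rewrite -mulr_natr -(mulr_natr pi 2); nra.
have sC : sin C = 1 by rewrite /C (periodicn (@sinD2pi R)) sin_pihalf.
have push t : t0 <= t -> kappa * d < kappa * rho t.
  by move=> /drho; rewrite ltr_pM2l.
exists C => t1 t01; move: zC; rewrite !ler_norml => /andP[zC zC'].
apply/andP; split.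
  rewrite -subr_ge0 opprK.
  apply: (@barrier R unit (fun _ t => z t + C) (fun _ t => dz t + 0) t0 t1 t01 _ _ _ tt).
  - move=> _ t /andP[t0t _]; apply: is_deriveD; exact: z'.
  - by move=> _; lra.
  - move=> t /andP[t0t _] _ _ /eqP; rewrite addr_eq0 => /eqP zt.
    have := zerr t t0t; have := push t t0t.
    by rewrite zt sinN sC ler_norml => ? /andP[]; lra.
rewrite -subr_ge0.
apply: (@barrier R unit (fun _ t => C - z t) (fun _ t => 0 - dz t) t0 t1 t01 _ _ _ tt).
- move=> _ t /andP[t0t _]; apply: is_deriveB; exact: z'.
- by move=> _; lra.
- move=> t /andP[t0t _] _ _ /subr0_eq zt.
  have := zerr t t0t; have := push t t0t.
  by rewrite -zt sC ler_norml => ? /andP[]; lra.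
Qed.

(* The variable theta + m omega satisfies a first-order equation, because
   m theta'' + theta' is its exact derivative. *)
Lemma winfree_flow_delayed (R : realType) (N : nat) (m kappa : R)
    (nu : 'I_N -> R) (theta omega : 'I_N -> R -> R) (i : 'I_N) (t : R) :
  0 < m -> 0 < t -> winfree_flow m kappa nu theta omega ->
  is_derive t 1 (fun s => theta i s + m * omega i s)
    (nu i - kappa * order_parameter theta t * sin (theta i t)).
Proof.
move=> m0 t0 /(_ i t t0)[th' om'].
apply: (is_derive_eq (is_deriveD th' (is_deriveZ m om'))) => /=.
rewrite -[_ *: _]/(_ * _).
by rewrite mulrCA divff ?gt_eqF// mulr1 addrC subrK.
Qed.

(** Shifting the argument of the sine by [m * omega i t] changes it by at most [m * B]; the factor 2
    bounds the order parameter. *)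
Lemma delayed_error (R : realType) (N : nat) (m kappa B a : R)
    (nu : 'I_N -> R) (theta omega : 'I_N -> R -> R) (i : 'I_N) (t : R) :
  0 < kappa -> 0 < m ->
  `|nu i| <= kappa * a -> `|omega i t| <= B ->
  `|nu i - kappa * order_parameter theta t * sin (theta i t)
    + kappa * order_parameter theta t * sin (theta i t + m * omega i t)|
  <= kappa * (a + 2 * (m * B)).
Proof.
move=> k0 m0 nua omB.
have N0 : (0 < N)%N by apply: leq_ltn_trans (ltn_ord i).
rewrite -addrA [- _ + _]addrC -mulrBr [leRHS]mulrDr.
rewrite (le_trans (ler_normD _ _))// lerD// -mulrA normrM (gtr0_norm k0).
rewrite ler_pM2l// normrM ler_pM//.
  by rewrite ger0_norm ?order_parameter_ge0// order_parameter_le2.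
rewrite (le_trans (sin_lipschitz _ _))// addrAC subrr add0r normrM gtr0_norm//.
by rewrite ler_pM2l.
Qed.

(** * Energy dissipation and relaxation to force balance *)

Lemma is_derive_sqr (R : realType) (f : R -> R) (t df : R) :
  is_derive t 1 f df -> is_derive t 1 (fun x => f x ^+ 2) (2 * f t * df).
Proof.
move=> f'; apply: (is_derive_eq (is_deriveX 2%N f')).
by rewrite -[LHS]/(_ * _) expr1.
Qed.

(* The first-order system is the gradient flow of the potential part, so this
   energy decreases at the rate of the friction. *)
Definition winfree_energy (R : realType) (N : nat) (m kappa : R)
    (nu : 'I_N -> R) (theta omega : 'I_N -> R -> R) (t : R) : R :=
  \sum_(i < N) (m / 2 * omega i t ^+ 2 - nu i * theta i t)
  - kappa * N%:R / 2 * order_parameter theta t ^+ 2.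

Lemma is_derive_winfree_energy (R : realType) (N : nat) (m kappa : R)
    (nu : 'I_N -> R) (theta omega : 'I_N -> R -> R) (t : R) :
  (0 < N)%N -> 0 < m -> 0 < t -> winfree_flow m kappa nu theta omega ->
  is_derive t 1 (winfree_energy m kappa nu theta omega)
    (- \sum_(i < N) omega i t ^+ 2).
Proof.
move=> N0 m0 t0 flow.
have th' i := (flow i t t0).1; have om' i := (flow i t t0).2.
have parts i := is_deriveB (is_deriveZ (m / 2) (is_derive_sqr (om' i)))
  (is_deriveZ (nu i) (th' i)).
have pot := is_deriveZ (kappa * N%:R / 2) (is_derive_sqr (is_derive_order_parameter th')).
apply: (is_derive_eq (is_deriveB (is_derive_fsum parts) pot)).
rewrite -[X in _ - X]/(_ * _).
set r := order_parameter theta t.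
(* The coupling is a gradient: [kappa * N / 2 * r^2] has partial derivative
   [- kappa * r * sin theta_i] in [theta_i]. *)
have -> : kappa * N%:R / 2 * (2 * r * (N%:R^-1 * \sum_(i < N) - sin (theta i t) * omega i t))
    = \sum_(i < N) kappa * r * (- sin (theta i t) * omega i t).
  by rewrite -mulr_sumr; field; rewrite pnatr_eq0 -lt0n.
rewrite -sumrB -sumrN; apply: eq_bigr => i _.
rewrite -![_ *: _]/(_ * _).
by field; rewrite gt_eqF.
Qed.

(** Barbalat's lemma is applied to the energy, which is monotone and bounded below since the phases
    are bounded, and then to the velocity. The force is recovered as [m * omega' + omega]. *)
Lemma winfree_flow_relaxes (R : realType) (N : nat) (m kappa B C t0 : R)
    (nu : 'I_N -> R) (theta omega : 'I_N -> R -> R) :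
  0 < m -> 0 < kappa -> 0 < t0 -> winfree_flow m kappa nu theta omega ->
  (forall i t, t0 <= t -> `|omega i t| <= B) ->
  (forall i t, t0 <= t -> `|theta i t| <= C) ->
  forall i, vanishes_pinfty (omega i) /\
    vanishes_pinfty (fun t => nu i - kappa * order_parameter theta t * sin (theta i t)).
Proof.
move=> m0 k0 t00 flow omB thC i.
have N0 : (0 < N)%N by apply: leq_ltn_trans (ltn_ord i).
have pos t : t0 <= t -> 0 < t by apply: lt_le_trans.
pose dom j t := (nu j - kappa * order_parameter theta t * sin (theta j t) - omega j t) / m.
have th' j t : t0 <= t -> is_derive t 1 (theta j) (omega j t).
  by move=> /pos/(flow j)[].
have om' j t : t0 <= t -> is_derive t 1 (omega j) (dom j t).
  by move=> /pos/(flow j)[].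
pose V := \sum_(j < N) `|nu j|.
have nuV j : `|nu j| <= V by rewrite /V (bigD1 j)//= lerDl sumr_ge0.
have R0 t := order_parameter_ge0 theta t.
have R2 t := order_parameter_le2 theta t N0.
have Rabs t : `|order_parameter theta t| <= 2 by rewrite ger0_norm.
have B0 : 0 <= B by apply: le_trans (omB i t0 _).
pose D := (V + kappa * 2 + B) / m.
have domD j t : t0 <= t -> `|dom j t| <= D.
  move=> t0t; rewrite normrM normfV (gtr0_norm m0) ler_pM2r ?invr_gt0//.
  rewrite (le_trans (ler_normB _ _))// lerD ?omB//.
  rewrite (le_trans (ler_normB _ _))// lerD//.
  rewrite -mulrA normrM (gtr0_norm k0) ler_pM2l// normrM -[leRHS]mulr1.
  by rewrite ler_pM// sin_max.
have omv j : vanishes_pinfty (omega j).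
  pose W t := - \sum_(k < N) omega k t ^+ 2.
  have Wv : vanishes_pinfty W.
    apply: (@barbalat R (winfree_energy m kappa nu theta omega) W
      (fun t => - \sum_(k < N) (2 * omega k t * dom k t)) t0
      (\sum_(k < N) (2 * B * D))).
    - by move=> t /pos t0t; apply: is_derive_winfree_energy.
    - move=> t t0t; apply: is_deriveN; apply: is_derive_fsum => k.
      by apply: is_derive_sqr; apply: om'.
    - move=> t t0t; rewrite normrN (le_trans (ler_norm_sum _ _ _))//.
      apply: ler_sum => k _; rewrite normrM ler_pM ?domD// normrM.
      by rewrite ger0_norm// ler_pM2l// omB.
    (* The lower bound drops the kinetic part, uses [nu_k theta_k <= V C], and takes 4 as the square
       of the largest possible order parameter. *)
    - apply: (@nonincreasing_lb_cauchy _ _ t0 (\sum_(k < N) - (V * C) - kappa * N%:R / 2 * 4)).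
        move=> s t t0s st; rewrite -subr_le0.
        have [|c /andP[sc ct] ->] := @mean_value _ (winfree_energy m kappa nu theta omega) W s t st.
          move=> x /andP[sx _]; apply: is_derive_winfree_energy => //.
          by rewrite (lt_le_trans t00)// (le_trans t0s).
        rewrite mulr_le0_ge0 ?subr_ge0// oppr_le0 sumr_ge0// => k _.
        exact: sqr_ge0.
      move=> t t0t; apply: lerB; last first.
        have kN : 0 <= kappa * N%:R / 2 by rewrite divr_ge0// mulr_ge0// ltW.
        apply: ler_wpM2l => //; rewrite (_ : 4 = 2 ^+ 2); last by rewrite -natrX.
        by rewrite lerXn2r ?nnegrE.
      apply: ler_sum => k _; rewrite -[leLHS]add0r lerD//.
        by rewrite mulr_ge0 ?sqr_ge0 ?divr_ge0// ltW.
      rewrite lerN2 (le_trans (ler_norm _))// normrM ler_pM//.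
      exact: thC.
  move=> e e0; have [|T hT] := Wv (e ^+ 2); first by rewrite exprn_gt0.
  exists T => t /hT; rewrite normrN ger0_norm; last first.
    by apply: sumr_ge0 => k _; apply: sqr_ge0.
  move=> h; rewrite -(@ler_pXn2r _ 2) ?nnegrE ?(ltW e0)// real_normK ?num_real//.
  rewrite (le_trans _ h)// (bigD1 j)//= lerDl sumr_ge0// => k _.
  exact: sqr_ge0.
split=> //.
have domv : vanishes_pinfty (dom i).
  pose dR t := N%:R^-1 * \sum_(j < N) (- sin (theta j t) * omega j t).
  have Rd t : t0 <= t -> is_derive t 1 (order_parameter theta) (dR t).
    by move=> t0t; apply: is_derive_order_parameter => j; apply: th'.
  have dRB t : t0 <= t -> `|dR t| <= B.
    move=> t0t; rewrite normrM ger0_norm ?invr_ge0//.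
    apply: le_trans (mean_le N0 (F := fun j => `|- sin (theta j t) * omega j t|) _).
      by rewrite ler_wpM2l ?invr_ge0// ler_norm_sum.
    move=> j; rewrite normrM normrN -[leRHS]mul1r ler_pM//; first exact: sin_max.
    exact: omB.
  pose dF t := order_parameter theta t * (cos (theta i t) * omega i t)
    + sin (theta i t) * dR t.
  have F' t : t0 <= t ->
      is_derive t 1 (fun s => order_parameter theta s * sin (theta i s)) (dF t).
    move=> t0t; have := is_deriveM (Rd t t0t) (is_derive_sin_comp (th' i t t0t)).
    by [].
  apply: (@barbalat R (omega i) (dom i)
    (fun t => m^-1 * (0 - kappa * dF t - dom i t)) t0
    (m^-1 * (kappa * (2 * B + B) + D))) => //.
  - move=> t t0t.
    rewrite [X in is_derive _ _ X _](_ : dom i = fun s => m^-1 * (nu i -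
        kappa * (order_parameter theta s * sin (theta i s)) - omega i s)); last first.
      by apply/funext => s; rewrite /dom mulrC mulrA.
    exact: (is_deriveZ m^-1 (is_deriveB (is_deriveB (is_derive_cst _ _ _)
      (is_deriveZ kappa (F' t t0t))) (om' i t t0t))).
  - move=> t t0t; rewrite normrM gtr0_norm ?invr_gt0// ler_pM2l ?invr_gt0//.
    rewrite (le_trans (ler_normB _ _))// lerD ?domD// sub0r normrN normrM gtr0_norm//.
    rewrite ler_pM2l// (le_trans (ler_normD _ _))// lerD//.
      rewrite normrM ler_pM// normrM -[leRHS]mul1r ler_pM//; last exact: omB.
      exact: cos_max.
    by rewrite normrM -[leRHS]mul1r ler_pM ?sin_max ?dRB.
  - exact: vanishes_cauchy.
move=> e e0.
have [|T1 h1] := omv i (e / 2); first by rewrite divr_gt0.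
have [|T2 h2] := domv (e / 2 / m); first by rewrite !divr_gt0.
exists (Num.max T1 T2) => t; rewrite ge_max => /andP[/h1 o1 /h2].
rewrite ler_pdivlMr// => o2.
have -> : nu i - kappa * order_parameter theta t * sin (theta i t) =
    dom i t * m + omega i t.
  by rewrite /dom divfK ?gt_eqF// subrK.
rewrite (le_trans (ler_normD _ _))// (splitr e) lerD//.
by rewrite normrM (gtr0_norm m0).
Qed.

(** * Phase locking *)

Lemma vanishes_uniform (R : realType) (N : nat) (f : 'I_N -> R -> R) :
  (forall i, vanishes_pinfty (f i)) -> forall e, 0 < e ->
  exists T, forall i t, T <= t -> `|f i t| <= e.
Proof.
move=> f0 e e0.
have [T hT] := fin_all_exists (fun i => f0 i e e0).
exists (\big[Num.max/0]_(i < N) T i) => i t Tt; apply: (hT i).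
exact: le_trans (le_bigmax _ _ i) Tt.
Qed.

Lemma derivable_ivt (R : realType) (f df : R -> R) (a b v : R) : a <= b ->
  (forall t, a <= t <= b -> is_derive t 1 f (df t)) ->
  Num.min (f a) (f b) <= v <= Num.max (f a) (f b) ->
  exists2 c, a <= c <= b & f c = v.
Proof.
move=> ab fdf vab; have [|c cab cv] := @IVT R f a b v ab _ vab.
  apply: derivable_within_continuous => x; rewrite in_itv/= => /fdf.
  by case.
by exists c.
Qed.

Lemma no_sign_change (R : realType) (f df : R -> R) (T : R) :
  (forall t, T <= t -> is_derive t 1 f (df t)) ->
  (forall t, T <= t -> f t != 0) ->
  forall s t, T <= s -> T <= t -> 0 < f s * f t.
Proof.
move=> fdf f0 s t.
wlog st : s t / s <= t.
  move=> h Ts Tt; have [st|/ltW ts] := leP s t; first exact: h.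
  by rewrite mulrC; apply: h.
move=> Ts Tt; rewrite ltNge; apply/negP => fst.
have [||c /andP[sc _] fc] := @derivable_ivt _ f df s t 0 st.
- by move=> x /andP[sx _]; apply: fdf; apply: le_trans sx.
- by rewrite ge_min le_max; have := f0 s Ts; have := f0 t Tt; nra.
by have := f0 c (le_trans Ts sc); rewrite fc eqxx.
Qed.

Lemma inv_dist_le (R : realType) (l x y : R) : 0 < l -> l <= x -> l <= y ->
  `|x^-1 - y^-1| <= `|x - y| / l ^+ 2.
Proof.
move=> l0 lx ly; have x0 := lt_le_trans l0 lx; have y0 := lt_le_trans l0 ly.
have -> : x^-1 - y^-1 = (y - x) * (x^-1 * y^-1).
  by field; rewrite !gt_eqF.
have xV : x^-1 <= l^-1 by rewrite lef_pV2.
have yV : y^-1 <= l^-1 by rewrite lef_pV2.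
rewrite normrM distrC ler_wpM2l// gtr0_norm ?mulr_gt0 ?invr_gt0//.
by rewrite -exprVn expr2 ler_pM// invr_ge0 ltW.
Qed.

(** Eventually [sin theta_i] is close to [n_i / Q] and the sign of [cos theta_i] is frozen, so [Q]
    nearly solves a fixed-point equation. As [1 / Q^2] has Lipschitz constant [2 / l^3] on [Q >= l],
    the bound [l^3 / 32] on [n_i^2] makes [(n_i / Q)^2] Lipschitz in [Q] with constant [1/16]; hence
    [Q] is Cauchy, and then so are the sines and the phases. *)
Lemma locked_phases (R : realType) (N : nat) (theta omega : 'I_N -> R -> R)
    (n : 'I_N -> R) (l t0 : R) : (0 < N)%N -> 0 < l ->
  (forall i t, t0 <= t -> is_derive t 1 (theta i) (omega i t)) ->
  (forall t, t0 <= t -> l <= order_parameter theta t) ->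
  (forall i, `|n i| <= l / 8) -> (forall i, n i ^+ 2 <= l ^+ 3 / 32) ->
  (forall i, vanishes_pinfty
    (fun t => n i - order_parameter theta t * sin (theta i t))) ->
  forall i, cauchy_pinfty (theta i).
Proof.
move=> N0 l0 th' Rl nl n2l res i0.
set Q := order_parameter theta in Rl res *.
(* Dividing the residual, at most [d * l], by [Q >= l] gives the first bound; [1/8 + 1/20 < 1/5]
   gives the third and [1 - 1/25 > (9/10)^2] the last. *)
have near_eq d : 0 < d -> d <= 1 / 20 -> exists2 T, t0 <= T & forall i t, T <= t ->
    [/\ `|sin (theta i t) - n i / Q t| <= d, `|n i / Q t| <= 1 / 8,
     `|sin (theta i t)| <= 1 / 5 & 9 / 10 <= `|cos (theta i t)| ].
  move=> d0 d1; have [T hT] := vanishes_uniform res (mulr_gt0 d0 l0).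
  exists (Num.max t0 T) => [|i t]; first by rewrite le_max lexx.
  rewrite ge_max => /andP[/Rl Qt /(hT i)].
  have Qt0 := lt_le_trans l0 Qt.
  have -> : n i - Q t * sin (theta i t) = (n i / Q t - sin (theta i t)) * Q t.
    by field; rewrite gt_eqF.
  rewrite normrM (gtr0_norm Qt0) distrC => h.
  have s1 : `|sin (theta i t) - n i / Q t| <= d.
    rewrite -(ler_pM2r Qt0) (le_trans h)// ler_pM2l//.
  have s2 : `|n i / Q t| <= 1 / 8.
    rewrite normrM normfV (gtr0_norm Qt0) ler_pdivrMr// (le_trans (nl i))//.
    by lra.
  have s3 : `|sin (theta i t)| <= 1 / 5.
    rewrite -[sin _](subrK (n i / Q t)) (le_trans (ler_normD _ _))//.
    by lra.
  split=> //; rewrite -(@ler_pXn2r _ 2) ?nnegrE// real_normK ?num_real// cos2sin2.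
  by move: s3; rewrite ler_norml => /andP[]; nra.
have same_sign T i : t0 <= T -> (forall t, T <= t -> 9 / 10 <= `|cos (theta i t)|) ->
    forall s t, T <= s -> T <= t -> 0 < cos (theta i s) * cos (theta i t).
  move=> t0T cT; apply: (@no_sign_change _ _ (fun t => - sin (theta i t) * omega i t)).
    by move=> t Tt; apply: is_derive_cos_comp; apply: th'; apply: le_trans Tt.
  by move=> t /cT; rewrite -normr_gt0; apply: lt_le_trans.
have inv_close T s t i : t0 <= T -> T <= s -> T <= t ->
    `|n i / Q s - n i / Q t| <= `|Q s - Q t| / (8 * l) /\
    `|(n i / Q s) ^+ 2 - (n i / Q t) ^+ 2| <= `|Q s - Q t| / 16.
  move=> t0T Ts Tt; have Qs := Rl s (le_trans t0T Ts); have Qt := Rl t (le_trans t0T Tt).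
  have := inv_dist_le l0 Qs Qt.
  have : `|(Q s)^-1 + (Q t)^-1| <= 2 / l.
    have Vs : (Q s)^-1 <= l^-1 by rewrite lef_pV2 ?posrE// (lt_le_trans l0).
    have Vt : (Q t)^-1 <= l^-1 by rewrite lef_pV2 ?posrE// (lt_le_trans l0).
    rewrite ger0_norm ?addr_ge0 ?invr_ge0 ?(le_trans (ltW l0))//.
    by lra.
  set x := (Q s)^-1; set y := (Q t)^-1; set D := `|Q s - Q t| => xy1 xy.
  have D0 : 0 <= D := normr_ge0 _.
  split.
    rewrite -mulrBr normrM (le_trans (ler_pM _ _ (nl i) xy))//.
    by rewrite le_eqVlt; apply/orP; left; apply/eqP; field; rewrite gt_eqF.
  rewrite !exprMn -mulrBr normrM ger0_norm ?sqr_ge0// subr_sqr normrM.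
  apply: (@le_trans _ _ (l ^+ 3 / 32 * (D / l ^+ 2 * (2 / l)))).
    by rewrite ler_pM ?sqr_ge0// ler_pM.
  by rewrite le_eqVlt; apply/orP; left; apply/eqP; field; rewrite gt_eqF.
have Qcauchy d T : 0 < d -> d <= 1 / 20 -> t0 <= T -> (forall i t, T <= t ->
    [/\ `|sin (theta i t) - n i / Q t| <= d, `|n i / Q t| <= 1 / 8,
     `|sin (theta i t)| <= 1 / 5 & 9 / 10 <= `|cos (theta i t)| ]) ->
    forall s t, T <= s -> T <= t -> `|Q s - Q t| <= 4 * d.
  move=> d0 d1 t0T hT s t Ts Tt.
  (* Absorbing the [1/16] term leaves at most [32/15 * d]. *)
  suff : `|Q s - Q t| <= `|Q s - Q t| / 16 + 2 * d by lra.
  apply: dist_order_parameter => // i.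
  have [s1 s2 s3 s4] := hT i s Ts; have [t1 t2 t3 t4] := hT i t Tt.
  have [_ nn] := inv_close T s t i t0T Ts Tt.
  have cc := same_sign T i t0T (fun u Tu => let: And4 _ _ _ h := hT i u Tu in h) s t Ts Tt.
  have sq u (x y : R) : `|x - y| <= u -> `|y| <= 1 / 8 -> `|x| <= 1 / 5 ->
      `|x ^+ 2 - y ^+ 2| <= u.
    move=> xy y8 x5; rewrite subr_sqr normrM -[leRHS]mulr1 ler_pM//.
    by rewrite (le_trans (ler_normD _ _))//; lra.
  have S1 := sq _ _ _ s1 s2 s3; have T1 := sq _ _ _ t1 t2 t3.
  (* Cosines of equal sign have a sum of modulus at least 1, so their difference is dominated by the
     difference of their squares. *)
  have sumc : 1 <= `|cos (theta i s) + cos (theta i t)|.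
    move: s4 t4 cc; set c := cos _; set c' := cos _ => s4 t4 cc.
    have [c0|c0] := ltP 0 c.
      have c'0 : 0 < c' by rewrite -(pmulr_rgt0 _ c0).
      by rewrite !gtr0_norm ?addr_gt0// in s4 t4 *; lra.
    have {}c0 : c < 0 by rewrite lt_neqAle c0 andbT; apply: contraTneq cc => ->; rewrite mul0r ltxx.
    have c'0 : c' < 0 by rewrite -(nmulr_rgt0 _ c0).
    have : c + c' < 0 by lra.
    by move=> ?; rewrite !ltr0_norm// in s4 t4 *; lra.
  apply: (@le_trans _ _ `|cos (theta i s) ^+ 2 - cos (theta i t) ^+ 2|).
    by rewrite subr_sqr normrM ler_peMr.
  rewrite !cos2sin2.
  move: S1 T1 nn; set X := sin (theta i s) ^+ 2; set Y := sin (theta i t) ^+ 2.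
  set X' := (n i / Q s) ^+ 2; set Y' := (n i / Q t) ^+ 2.
  move=> S1 T1 nn.
  have -> : 1 - X - (1 - Y) = (Y - Y') - (X - X') - (X' - Y') by ring.
  rewrite (le_trans (ler_normB _ _))// (le_trans (lerD (ler_normB _ _) (lexx _)))//.
  by lra.
move=> e e0.
(* [2 d] bounds the two sine errors, and [4 d / (8 l)] the variation of [n i0 / Q]. *)
pose K := 2 + 1 / (2 * l).
have K0 : 0 < K by rewrite addr_gt0// divr_gt0// mulr_gt0.
pose d := Num.min (1 / 20) (e / 2 / K).
have d0 : 0 < d by rewrite lt_min !divr_gt0.
have d1 : d <= 1 / 20 by rewrite /d ge_min lexx.
have dK : d * K <= e / 2 by rewrite -ler_pdivlMr// /d ge_min lexx orbT.
have [T t0T hT] := near_eq d d0 d1.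
exists T => s t.
wlog st : s t / s <= t.
  by move=> h Ts Tt; have [/h|/ltW/h] := leP s t; [|rewrite distrC]; apply.
move=> Ts Tt.
have QQ := Qcauchy d T d0 d1 t0T hT s t Ts Tt.
have [nn _] := inv_close T s t i0 t0T Ts Tt.
have [s1 _ _ _] := hT i0 s Ts; have [t1 _ _ _] := hT i0 t Tt.
have sins : `|sin (theta i0 s) - sin (theta i0 t)| <= d * K.
  have -> : sin (theta i0 s) - sin (theta i0 t) =
    (sin (theta i0 s) - n i0 / Q s) - (sin (theta i0 t) - n i0 / Q t)
    + (n i0 / Q s - n i0 / Q t) by ring.
  rewrite (le_trans (ler_normD _ _))// (le_trans (lerD (ler_normB _ _) (lexx _)))//.
  have : `|Q s - Q t| / (8 * l) <= 4 * d / (8 * l).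
    by rewrite ler_pM2r// invr_gt0 mulr_gt0.
  have -> : 4 * d / (8 * l) = d * (1 / (2 * l)) by field; rewrite gt_eqF.
  by rewrite /K; lra.
(* The mean value point [c] of the sine lies between the two phases, so it is attained by [theta i0]
   at some time [u] between [s] and [t], where [|cos| >= 9/10]. This excludes distinct angles with
   nearly equal sines. *)
pose a := Num.min (theta i0 s) (theta i0 t); pose b := Num.max (theta i0 s) (theta i0 t).
have ab : a <= b by rewrite ge_min !le_max lexx.
have [c cab E] := mean_value ab (fun t _ => is_derive_sin t).
have [|u /andP[su ut] uc] := @derivable_ivt _ (theta i0) (omega i0) s t c st _ cab.
  by move=> x /andP[sx _]; apply: th'; rewrite (le_trans t0T)// (le_trans Ts).
have [_ _ _ cu] := hT i0 u (le_trans Ts su).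
have absE : `|sin b - sin a| = `|sin (theta i0 s) - sin (theta i0 t)|.
  rewrite /a /b; case: (leP (theta i0 s) (theta i0 t)) => _ //.
  exact: distrC.
have absD : `|b - a| = `|theta i0 s - theta i0 t|.
  rewrite /a /b; case: (leP (theta i0 s) (theta i0 t)) => _ //.
  exact: distrC.
move: absE; rewrite E normrM absD -uc => E'.
have := normr_ge0 (theta i0 s - theta i0 t).
by nra.
Qed.

(** * Numerical constants and conclusion *)

(** These two facts are all that is kept of the power [3/2], so that later estimates are
    polynomial. *)
Lemma powR_three_halves (R : realType) (x : R) : 0 < x ->
  0 < x `^ (3 / 2) /\ (x `^ (3 / 2)) ^+ 2 = x ^+ 3.
Proof.
move=> x0; split; first exact: powR_gt0.
rewrite -powR_mulrn ?powR_ge0// -powRrM -[RHS]powR_mulrn ?ltW//.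
by congr (_ `^ _); field.
Qed.

(** Here [|r| = x sqrt x <= sqrt 2 * x], and [17/12] is a rational just above [sqrt 2]. *)
Lemma three_halves_le (R : realType) (x r : R) :
  0 < x -> x <= 2 -> r ^+ 2 = x ^+ 3 -> r <= 17 / 12 * x.
Proof.
move=> x0 x2 rx; rewrite leNgt; apply/negP => h.
have x20 : 0 < x ^+ 2 by rewrite exprn_gt0.
have : (17 / 12 * x) ^+ 2 < r ^+ 2 by nra.
rewrite rx exprMn exprS ltr_pM2r//.
by lra.
Qed.

Lemma max_abs_lt (R : realType) (N : nat) (x : 'I_N -> R) (kappa c : R)
    (i : 'I_N) : 0 < kappa -> max_abs x / kappa < c -> `|x i| < kappa * c.
Proof.
move=> k0; rewrite ltr_pdivrMr// mulrC; apply: le_lt_trans.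
exact: (le_bigmax _ (fun i => `|x i|)).
Qed.

(** The persistence criterion [d^2 <= (q - 2 p) (q - e)^2] balances when [d] and [e] are multiples
    of [r] and [p], [q] multiples of [R0]: both sides then scale as [R0^3], whence the exponent
    [3/2]. *)
Lemma winfree_flow_order_bound (R : realType) (N : nat) (m kappa R0 r t0 : R)
    (nu : 'I_N -> R) (theta omega : 'I_N -> R -> R) :
  (0 < N)%N -> 0 < m -> 0 < kappa -> 0 < R0 -> R0 <= 2 ->
  0 < r -> r ^+ 2 = R0 ^+ 3 -> 0 < t0 ->
  winfree_flow m kappa nu theta omega ->
  (forall i, `|nu i| <= kappa * (1 / 50 * r)) -> m * kappa <= 1 / 80 * r ->
  (forall i t, t0 <= t -> `|omega i t| <= kappa * (21 / 10)) ->
  19 / 20 * R0 <= order_parameter theta t0 ->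
  (forall t, t0 <= t -> R0 / 4 <= order_parameter theta t) /\
  exists C, forall i t, t0 <= t -> `|theta i t| <= C.
Proof.
move=> N0 m0 k0 R00 R02 r0 rR t00 flow nur mk omB Rt0.
have rR0 := three_halves_le R00 R02 rR.
(* [e] bounds the shift [m * omega]; [d] adds the frequency part [r / 50] to twice that shift, in
   total [29/400 * r]. *)
pose B := kappa * (21 / 10); pose e := 21 / 10 * (1 / 80 * r); pose d := 1 / 50 * r + 2 * e.
have mB : m * B <= e.
  have -> : m * B = (21 / 10) * (m * kappa) by rewrite /B; ring.
  by rewrite /e; lra.
pose z i t := theta i t + m * omega i t.
pose dz i t := nu i - kappa * order_parameter theta t * sin (theta i t).
have pos t : t0 <= t -> 0 < t by apply: lt_le_trans.
have z' i t : t0 <= t -> is_derive t 1 (z i) (dz i t).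
  by move=> /pos t1; apply: winfree_flow_delayed.
have zerr i t : t0 <= t ->
    `|dz i t + kappa * order_parameter theta t * sin (z i t)| <= kappa * d.
  move=> t0t; apply: le_trans (delayed_error _ k0 m0 (nur i) (omB i t t0t)) _.
  by rewrite ler_pM2l// lerD2l ler_pM2l.
have Qrho t : t0 <= t -> `|order_parameter z t - order_parameter theta t| <= e.
  move=> t0t; apply: dist_order_parameter => // i.
  rewrite (le_trans (cos_lipschitz _ _))// /z [theta i t + _]addrC addrK.
  rewrite normrM gtr0_norm// (le_trans _ mB)// ler_pM2l//.
  exact: omB.
have Qlb t : t0 <= t -> 2 / 5 * R0 <= order_parameter z t.
  (* The level [q = 9/10 R0] lies below [19/20 R0 - e], and [p = 2/5 R0] leaves [q - 2 p = R0 / 10];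
     the criterion then reduces to [(29/400)^2 < 8/125]. *)
  apply: (@order_parameter_persists _ _ z dz (order_parameter theta) kappa d e (9 / 10 * R0)) => //.
  - by have := Qrho t0 (lexx _); rewrite ler_norml /e => /andP[]; lra.
  - by rewrite /e; lra.
  - by rewrite /d /e; lra.
  - have -> : 9 / 10 * R0 - 2 * (2 / 5 * R0) = 1 / 10 * R0 by field.
    have -> : d ^+ 2 = (29 / 400) ^+ 2 * R0 ^+ 3 by rewrite -rR /d /e; field.
    have h : 4 / 5 * R0 <= 9 / 10 * R0 - e by rewrite /e; lra.
    apply: (@le_trans _ _ (1 / 10 * R0 * (4 / 5 * R0) ^+ 2)).
      have R30 : 0 < R0 ^+ 3 by rewrite exprn_gt0.
      have -> : 1 / 10 * R0 * (4 / 5 * R0) ^+ 2 = 8 / 125 * R0 ^+ 3 by field.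
      by rewrite (ler_pM2r R30); lra.
    rewrite ler_pM2l; last by lra.
    by rewrite lerXn2r// nnegrE; lra.
  - by lra.
have Rlb t : t0 <= t -> 1 / 3 * R0 <= order_parameter theta t.
  move=> t0t; have := Qlb t t0t; have := Qrho t t0t.
  by rewrite ler_norml /e => /andP[]; lra.
split; first by move=> t /Rlb; lra.
have bounded i : exists C, forall t, t0 <= t -> `|z i t| <= C.
  apply: (@phase_bounded R (z i) (dz i) (order_parameter theta) kappa d t0 k0 (z' i) (zerr i)).
  by move=> t /Rlb; apply: lt_le_trans; rewrite /d /e; lra.
have [C hC] := fin_all_exists bounded.
exists (\big[Num.max/0]_(i < N) C i + e) => i t t0t.
rewrite -[theta i t](addrK (m * omega i t)) (le_trans (ler_normB _ _))// lerD//.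
  by rewrite (le_trans (hC i t t0t))// le_bigmax.
by rewrite normrM gtr0_norm// (le_trans _ mB)// ler_pM2l// omB.
Qed.

Theorem theorem1p1 (R : realType) (N : nat) (m kappa : R)
    (nu theta0 omega0 : 'I_N -> R) (theta : 'I_N -> R -> R) :
  let a : R := 1 / 50 in
  let b : R := 1 / 80 in
  let c : R := 1 / 20 in
  let R0 : R := order_parameter theta 0 in
  (1 <= N)%N -> 0 < m -> 0 < kappa ->
  winfree_solution m kappa nu theta0 omega0 theta ->
  0 < R0 ->
  max_abs nu / kappa < a * R0 `^ (3 / 2) ->
  m * kappa < b * R0 `^ (3 / 2) ->
  max_abs omega0 / kappa < c * R0 `^ (3 / 2) ->
  (forall i : 'I_N,
     (exists theta_oo : R, theta i t @[t --> +oo] --> theta_oo) /\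
     derive1 (theta i) t @[t --> +oo] --> 0) /\
  R0 / 4 <= inf [set order_parameter theta t | t in [set t : R | 0 <= t]].
Proof.
move=> a b c R0 N0 m0 k0 sol R00 nur mk omr.
have R02 : R0 <= 2 := order_parameter_le2 _ _ N0.
have [r0 rR] := powR_three_halves R00.
move: (R0 `^ (3 / 2)) => r in r0 rR nur mk omr.
have nu_le i : `|nu i| <= kappa * (1 / 50 * r) by apply/ltW/max_abs_lt.
(* A rational just above [2^(3/2)]. *)
have r3 : r <= 283 / 100.
  rewrite -(@ler_pXn2r _ 2) ?nnegrE ?(ltW r0)// rR.
  by apply: (@le_trans _ _ (2 ^+ 3)); [rewrite lerXn2r ?nnegrE ?(ltW R00)|lra].
have om0 i : `|omega0 i| < kappa * (21 / 10).
  apply: lt_le_trans (max_abs_lt i k0 omr) _.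
  by rewrite ler_pM2l// /c; lra.
have [|t0 t00 start] := winfree_solution_start (e := R0 / 20) sol _ om0.
  by rewrite divr_gt0.
have flow := winfree_solution_flow m0 sol.
set omega := fun i => derive1 (theta i) in flow.
(* The constant [21/10] exceeds [2 + r / 50], the force bound divided by [kappa]. *)
have omB i t : t0 <= t -> `|omega i t| <= kappa * (21 / 10).
  apply: (winfree_flow_speed m0 k0 t00 flow).
    apply: (@le_lt_trans _ _ (kappa * (1 / 50 * r) + 2 * kappa)); first by rewrite lerD2r.
    by rewrite [2 * _]mulrC -mulrDr ltr_pM2l//; lra.
  by have [|_] := start t0 _ i; [rewrite t00 lexx|].
have early t : 0 < t <= t0 -> 19 / 20 * R0 <= order_parameter theta t.
  move=> tt0; have : `|order_parameter theta t - R0| <= R0 / 20.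
    apply: dist_order_parameter => // i.
    by rewrite (le_trans (cos_lipschitz _ _))//; have [] := start t tt0 i.
  by rewrite ler_norml => /andP[]; lra.
have [late [C thC]] := winfree_flow_order_bound N0 m0 k0 R00 R02 r0 rR t00 flow
  nu_le (ltW mk) omB (early t0 ltac:(by rewrite t00 lexx)).
split; last first.
  apply: lb_le_inf; first by exists R0, 0 => /=.
  move=> _ [t /= t_ge0 <-]; have [->|tn0] := eqVneq t 0; first by rewrite -/R0; lra.
  have tpos : 0 < t by rewrite lt_neqAle eq_sym tn0.
  have [tt0|/ltW/late//] := leP t t0.
  by have := early t; rewrite tpos tt0 => /(_ isT); lra.
have relax := winfree_flow_relaxes m0 k0 t00 flow omB thC.
move=> i; split; last exact: vanishes_cvg (relax i).1.
apply: cauchy_pinfty_cvg.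
have n_le j : `|nu j / kappa| <= 1 / 50 * r.
  by rewrite normrM normfV (gtr0_norm k0) ler_pdivrMr// mulrC.
(* With [l = R0 / 4], the squares may reach [l^3 / 32 = R0^3 / 2048], while the frequencies give at
   most [(r / 50)^2 = R0^3 / 2500]. *)
apply: (@locked_phases _ _ theta omega (fun j => nu j / kappa) (R0 / 4) t0) => //.
- by rewrite divr_gt0.
- by move=> j t t0t; have [] := flow j t (lt_le_trans t00 t0t).
- move=> j; apply: le_trans (n_le j) _.
  by have := three_halves_le R00 R02 rR; lra.
- move=> j; rewrite -real_normK ?num_real//.
  apply: (@le_trans _ _ ((1 / 50 * r) ^+ 2)).
    by rewrite lerXn2r// nnegrE mulr_ge0 ?(ltW r0).
  have R30 : 0 < R0 ^+ 3 by rewrite exprn_gt0.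
  by rewrite exprMn rR [(R0 / 4) ^+ 3]exprMn; lra.
- move=> j e e0; have [|T hT] := (relax j).2 (kappa * e); first by rewrite mulr_gt0.
  exists T => t /hT h; rewrite -(ler_pM2l k0); apply: le_trans h.
  rewrite -{1}(gtr0_norm k0) -normrM mulrBr mulrCA divff ?gt_eqF// mulr1.
  by rewrite mulrA.
Qed.
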